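(* Let $R$ be a complete discrete valuation ring with uniformizer $\pi$ and residue field $k$, let $n,r\in\mathbb{N}$, let $\mathfrak{X}=\mathrm{Spf}\,R[[S_1,\ldots,S_n,Z]]$, and let $f\in R[[S_1,\ldots,S_n,Z]]$ be a $Z$-distinguished power series. Let $\mathfrak{X}'\to\mathfrak{X}$ be the affine part of the admissible blowup of $\mathfrak{X}$ in the ideal $(\pi^{r+1},S_1,\ldots,S_n)$ where the pullback ideal is generated by $\pi^{r+1}$. Consider the cartesian diagram of $R$-envelopes and non-vanishing loci of $f$ consisting of the open immersions $\mathfrak{X}_{\pi,f}\hookrightarrow\mathfrak{X}_\pi$ and $(\mathfrak{X}')_{\pi,f}\hookrightarrow(\mathfrak{X}')_\pi$ and of the natural morphisms $(\mathfrak{X}')_\pi\to\mathfrak{X}_\pi$ and $(\mathfrak{X}')_{\pi,f}\to\mathfrak{X}_{\pi,f}$. Let $g$ and $h$ be global functions on $\mathfrak{X}_{\pi,f}$ and on $(\mathfrak{X}')_\pi$ respectively whose pullbacks to $(\mathfrak{X}')_{\pi,f}$ coincide. Then $g$ and $h$ are the pullbacks of a unique global function on $\mathfrak{X}_\pi$.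
   Context: $f$ is $Z$-distinguished if its image in $k[[Z]]$ (reduction modulo $\pi,S_1,\ldots,S_n$) is a nonzero non-unit. For an affine formal $R$-scheme $\mathfrak{S}=\mathrm{Spf}\,A$ of formally finite type over $R$ (i.e. $A$ is a topological quotient of some $R[[X_1,\ldots,X_a]]\langle Y_1,\ldots,Y_b\rangle$), the $R$-envelope is $\mathfrak{S}_\pi=\mathrm{Spf}\,A^\pi$, where $A^\pi$ is the ring $A$ equipped with its $\pi$-adic topology (for which it is complete and separated). An admissible blowup is a formal blowup in a $\pi$-adically open coherent ideal; explicitly, $\mathfrak{X}'=\mathrm{Spf}\,R[[S_1,\ldots,S_n,Z]]\langle S_1/\pi^{r+1},\ldots,S_n/\pi^{r+1}\rangle$ (the quotient of $R[[S_1,\ldots,S_n,Z]]\langle T_1,\ldots,T_n\rangle$ by the relations $\pi^{r+1}T_j=S_j$). $\mathfrak{X}_{\pi,f}$ and $(\mathfrak{X}')_{\pi,f}$ are the open formal subschemes of $\mathfrak{X}_\pi$ and $(\mathfrak{X}')_\pi$ where $f$ does not vanish; their rings of functions are the $\pi$-adic completions of the localizations at $f$ of the rings of functions of $\mathfrak{X}$ and $\mathfrak{X}'$, respectively. *)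

(* Defs.v *)
From HB Require Import structures.
From mathcomp Require Import all_boot all_order all_algebra.
From mathcomp Require Import ring.
From mathcomp Require Import boolp ssrcomplements mpoly.

Set Implicit Arguments.
Unset Strict Implicit.
Unset Printing Implicit Defensive.

Import GRing.Theory.
Local Open Scope ring_scope.
Local Open Scope quotient_scope.

Section PowerSeries.
Variables (n : nat) (K : comPzRingType).

Definition mpseries := 'X_{1..n} -> K.

HB.instance Definition _ := Choice.copy mpseries ('X_{1..n} -> K).

Implicit Types (f g h : mpseries) (m : 'X_{1..n}).

Definition mps_zero : mpseries := fun _ => 0.
Definition mps_opp f : mpseries := fun m => - f m.
Definition mps_add f g : mpseries := fun m => f m + g m.
Definition mpsC (c : K) : mpseries := fun m => if m == 0%MM then c else 0.
Definition mpsX (i : 'I_n) : mpseries := fun m => (m == U_(i)%MM)%:R.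
Definition mps_mul f g : mpseries := fun m =>
  \sum_(k : 'X_{1..n < (mdeg m).+1} | (k <= m)%MM) f k * g (m - k)%MM.

Fact mps_addA : associative mps_add.
Proof. by move=> f g h; apply/funext => m; rewrite /mps_add addrA. Qed.
Fact mps_addC : commutative mps_add.
Proof. by move=> f g; apply/funext => m; rewrite /mps_add addrC. Qed.
Fact mps_add0 : left_id mps_zero mps_add.
Proof. by move=> f; apply/funext => m; rewrite /mps_add add0r. Qed.
Fact mps_addN : left_inverse mps_zero mps_opp mps_add.
Proof. by move=> f; apply/funext => m; rewrite /mps_add addNr. Qed.

HB.instance Definition _ :=
  GRing.isZmodule.Build mpseries mps_addA mps_addC mps_add0 mps_addN.

Lemma mps_mulE b f g m : (mdeg m < b)%N ->
  mps_mul f g m = \sum_(k : 'X_{1..n < b} | (k <= m)%MM) f k * g (m - k)%MM.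
Proof.
move=> lt_mb; apply/esym; rewrite /mps_mul.
pose F (k : 'X_{1..n}) := f k * g (m - k)%MM.
rewrite (big_sub_widen ('X_{1..n < (mdeg m).+1} : subFinType _)
  ('X_{1..n < b} : subFinType _) (fun k => k <= m)%MM F) /=; last first.
  by move=> x /leq_trans; apply.
apply: eq_bigl => k; case: (boolP (k <= m)%MM) => //= le_km.
by apply/esym; rewrite -(submK le_km) mdegD ltnS leq_addl.
Qed.

Lemma mps_mulE_rev b f g m : (mdeg m < b)%N ->
  mps_mul f g m = \sum_(k : 'X_{1..n < b} | (k <= m)%MM) f (m - k)%MM * g k.
Proof.
move=> lt_mb; rewrite (mps_mulE _ _ lt_mb).
have pr (h : 'X_{1..n}) : (mdeg (m - h)%MM < b)%N.
  exact: leq_ltn_trans (mdegB _ _) _.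
pose F (k : 'X_{1..n < b}) := BMultinom (pr k).
have inv_F (h : 'X_{1..n}): (h <= m)%MM -> (m - (m - h))%MM = h.
  by move=> le_hm; rewrite submBA // addmC addmK.
rewrite (reindex_onto F F) //=; last first.
  by move=> h /inv_F eqh; apply/eqP; rewrite eqE /= eqh.
apply/esym/eq_big => [h /=|h /inv_F -> //]; apply/esym; rewrite lem_subr eqE /=.
by apply/eqP/idP => [<-|/inv_F //]; apply/mnm_lepP=> i; rewrite !mnmBE leq_subr.
Qed.

Fact mps_mulC : commutative mps_mul.
Proof.
move=> f g; apply/funext => m.
rewrite (mps_mulE_rev _ _ (leqnn _)) (mps_mulE _ _ (leqnn _)).
by apply: eq_bigr => k _; rewrite mulrC.
Qed.

Fact mps_mulA : associative mps_mul.
Proof.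
move=> p q r; apply/funext=> mi; set b := (mdeg mi).+1.
have lt_b : (mdeg mi < b)%N by [].
rewrite (mps_mulE _ _ lt_b) (mps_mulE_rev _ _ lt_b).
have h m: (mdeg (mi - m)%MM < b)%N by exact/(leq_ltn_trans (mdegB mi m)).
pose coef3 mj mk := p mj * (q (mi - mj - mk)%MM * r mk).
transitivity (\sum_(mj : 'X_{1..n < b} | (mj <= mi)%MM)
                \sum_(mk : 'X_{1..n < b} | (mk <= mi - mj)%MM)
                   coef3 mj mk).
  by apply/eq_bigr=> /= mj _; rewrite (@mps_mulE_rev b) 1?big_distrr.
pose P (mj : 'X_{1..n < b}) := (mj <= mi)%MM.
rewrite (exchange_big_dep P) //= {}/P; last first.
  by move=> mj mk _ /lepm_trans; apply; apply/lem_subr.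
apply/eq_bigr=> /= mk /mnm_lepP le_mk_mi.
transitivity (\sum_(mj : 'X_{1..n < b} | (mj <= mi - mk)%MM) coef3 mj mk).
+ apply/eq_bigl=> m /=.
  apply/idP/idP => [/andP[/mnm_lepP le1 /mnm_lepP le2]|le1].
  * apply/mnm_lepP => i; rewrite mnmBE /leq subnBA // addnC -subnBA //.
    by rewrite -mnmBE; apply/le2.
  * have le2: (m <= mi)%MM by rewrite (lepm_trans le1) ?lem_subr.
    rewrite le2; apply/mnm_lepP=> i; rewrite mnmBE /leq.
    move/mnm_lepP: le2 => le2; rewrite subnBA // addnC.
    by rewrite -subnBA //; move/mnm_lepP/(_ i): le1; rewrite mnmBE.
rewrite (@mps_mulE b) /coef3 1?big_distrl //=.
by apply/eq_bigr=> mj le_mj_miBk; rewrite !mulrA !submDA addmC.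
Qed.

Lemma mpsC_mulE c f m : mps_mul (mpsC c) f m = c * f m.
Proof.
rewrite /mps_mul (bigD1 bm0) /=; last by apply/mnm_lepP => i; rewrite mnm0E.
rewrite big1 => [|k /andP[_ k0]].
  by rewrite subm0 addr0 /mpsC eqxx.
by rewrite /mpsC ifN ?mul0r.
Qed.

Fact mps_mul1 : left_id (mpsC 1) mps_mul.
Proof. by move=> f; apply/funext => m; rewrite mpsC_mulE mul1r. Qed.

Fact mps_mulDl : left_distributive mps_mul mps_add.
Proof.
move=> f g h; apply/funext => m; rewrite /mps_mul /mps_add -big_split /=.
by apply: eq_bigr => k _; rewrite mulrDl.
Qed.

HB.instance Definition _ := GRing.Zmodule_isComPzRing.Build mpseries
  mps_mulA mps_mulC mps_mul1 mps_mulDl.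

Lemma mpsC_zmod : zmod_morphism mpsC.
Proof.
move=> a b; apply/funext => m.
change (mpsC (a - b) m = mpsC a m - mpsC b m); rewrite /mpsC.
by case: eqP => // _; rewrite subr0.
Qed.
Lemma mpsC_monoid : monoid_morphism mpsC.
Proof.
split=> // a b; apply/funext => m.
change (mpsC (a * b) m = mps_mul (mpsC a) (mpsC b) m).
by rewrite mpsC_mulE /mpsC; case: eqP; rewrite ?mulr0.
Qed.
HB.instance Definition _ := GRing.isZmodMorphism.Build K mpseries mpsC mpsC_zmod.
HB.instance Definition _ :=
  GRing.isMonoidMorphism.Build K mpseries mpsC mpsC_monoid.

End PowerSeries.

Arguments mpsC n {K} c.
Arguments mpsX {n} K i.

Section Ideals.
Variable K : comPzRingType.
Implicit Types (G I : K -> Prop).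

Definition ideal_gen G (x : K) : Prop :=
  exists2 s : seq (K * K), (forall p, p \in s -> G p.2) &
    x = \sum_(p <- s) p.1 * p.2.

Definition ideal_exp I (N : nat) : K -> Prop :=
  ideal_gen (fun x => exists2 y : 'I_N -> K,
    (forall i, I (y i)) & x = \prod_(i < N) y i).

Definition is_ideal I : Prop :=
  [/\ I 0, forall x y, I x -> I y -> I (x + y) & forall a x, I x -> I (a * x)].

Lemma ideal_genP G : is_ideal (ideal_gen G).
Proof.
split; first by exists [::] => //; rewrite big_nil.
  move=> _ _ [s Gs ->] [t Gt ->]; exists (s ++ t); last by rewrite big_cat.
  by move=> p; rewrite mem_cat => /orP[/Gs|/Gt].
move=> a _ [s Gs ->]; exists [seq (a * p.1, p.2) | p <- s].
  by move=> _ /mapP[p /Gs Gp ->].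
by rewrite big_map mulr_sumr; apply: eq_bigr => p _; rewrite mulrA.
Qed.

Lemma mem_ideal_gen G x : G x -> ideal_gen G x.
Proof.
move=> Gx; exists [:: (1, x)]; last by rewrite big_seq1 mul1r.
by move=> p; rewrite inE => /eqP ->.
Qed.

Definition ideal_pred G : {pred K} := fun x => `[< ideal_gen G x >].

Fact ideal_pred_zmod G : zmod_closed (ideal_pred G).
Proof.
have [I0 ID IM] := ideal_genP G.
split=> [|x y /asboolP Ix /asboolP Iy]; first exact/asboolP.
by apply/asboolP/ID => //; rewrite -mulN1r; apply: IM.
Qed.
HB.instance Definition _ G :=
  GRing.isZmodClosed.Build K (ideal_pred G) (ideal_pred_zmod G).

Definition quot_ideal G := Quotient.quot (ideal_pred G).

Section QuotIdeal.
Variable G : K -> Prop.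
Local Notation Q := (quot_ideal G).

HB.instance Definition _ := GRing.Zmodule.on Q.
HB.instance Definition _ := EqQuotient.on Q.

Lemma quot_idealP (x y : K) : ideal_gen G (x - y) <-> \pi_Q x = \pi_Q y.
Proof.
split=> [Gxy|]; last by move/eqP; rewrite -Quotient.idealrBE => /asboolP.
by apply/eqP; rewrite -Quotient.idealrBE; apply/asboolP.
Qed.

Definition quot_one : Q := \pi_Q 1.
Definition quot_mul (x y : Q) : Q := \pi_Q (repr x * repr y).

Lemma quot_mul_pi x y : quot_mul (\pi_Q x) (\pi_Q y) = \pi_Q (x * y).
Proof.
have [_ ID IM] := ideal_genP G.
have rK z : ideal_gen G (repr (\pi_Q z) - z) by apply/quot_idealP; rewrite reprK.
apply/quot_idealP; set a := repr _; set b := repr _.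
have -> : a * b - x * y = b * (a - x) + x * (b - y).
  by rewrite !mulrBr ![b * _]mulrC addrA subrK.
by apply: ID; apply: IM; apply: rK.
Qed.

Fact quot_mulA : associative quot_mul.
Proof.
elim/quotW=> x; elim/quotW=> y; elim/quotW=> z.
by rewrite (quot_mul_pi y z) (quot_mul_pi x y) !quot_mul_pi mulrA.
Qed.
Fact quot_mulC : commutative quot_mul.
Proof. by move=> x y; rewrite /quot_mul mulrC. Qed.
Fact quot_mul1 : left_id quot_one quot_mul.
Proof. by move=> x; rewrite -[x]reprK quot_mul_pi mul1r. Qed.
Fact quot_mulDl : left_distributive quot_mul +%R.
Proof.
elim/quotW=> x; elim/quotW=> y; elim/quotW=> z.
have piD a b : \pi_Q a + \pi_Q b = \pi_Q (a + b).
  exact/esym/Quotient.pi_add.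
by rewrite piD (quot_mul_pi x z) (quot_mul_pi y z) quot_mul_pi piD mulrDl.
Qed.
HB.instance Definition _ := GRing.Zmodule_isComPzRing.Build Q
  quot_mulA quot_mulC quot_mul1 quot_mulDl.

Definition quot_pi (x : K) : Q := \pi_Q x.

Lemma quot_pi_zmod : zmod_morphism quot_pi.
Proof.
move=> x y; rewrite /quot_pi.
have -> : \pi_Q (x - y) = \pi_Q x + \pi_Q (- y) by exact: Quotient.pi_add.
by congr (_ + _); apply: Quotient.pi_opp.
Qed.
Lemma quot_pi_monoid : monoid_morphism quot_pi.
Proof. by split=> // x y; apply/esym/quot_mul_pi. Qed.
HB.instance Definition _ := GRing.isZmodMorphism.Build K Q quot_pi quot_pi_zmod.
HB.instance Definition _ :=
  GRing.isMonoidMorphism.Build K Q quot_pi quot_pi_monoid.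

End QuotIdeal.
End Ideals.

Section Localization.
Variables (K : comPzRingType) (f : K).
Implicit Types (x y : K * nat).

(* (a, i) stands for the fraction a / f ^ i. *)
Definition loc_eq x y : bool :=
  `[< exists k, f ^+ k * (f ^+ y.2 * x.1 - f ^+ x.2 * y.1) = 0 >].

Lemma loc_eqP x y : reflect
  (exists k, f ^+ (k + y.2) * x.1 = f ^+ (k + x.2) * y.1) (loc_eq x y).
Proof.
apply: (iffP (asboolP _)) => -[k kP]; exists k.
  by apply/eqP; rewrite -subr_eq0 !exprD -!mulrA -mulrBr kP.
by rewrite mulrBr !mulrA -!exprD kP subrr.
Qed.

Lemma eq_lincomb (u v c d c' d' x y : K) :
  c = d -> c' = d' -> u - v = x * (c - d) + y * (c' - d') -> u = v.
Proof.
by move=> -> -> /eqP; rewrite !subrr !mulr0 addr0 subr_eq0 => /eqP.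
Qed.

Fact loc_eq_equiv : equiv_class_of loc_eq.
Proof.
split=> [x|x y|y x z].
- by apply/loc_eqP; exists 0%N.
- by apply/loc_eqP/loc_eqP => -[k]; exists k.
case: x y z => [a i] [b j] [c l] /loc_eqP[k /= kP] /loc_eqP[k' /= k'P].
apply/loc_eqP; exists (k + k' + j)%N; rewrite /=.
move: kP k'P; rewrite !exprD => kP k'P.
apply: (eq_lincomb (x := f ^+ k' * f ^+ l) (y := f ^+ k * f ^+ i) kP k'P).
ring.
Qed.

Canonical loc_equiv := EquivRelPack loc_eq_equiv.
Canonical loc_encModRel := defaultEncModRel loc_eq.

Definition localization := {eq_quot loc_eq}.
HB.instance Definition _ := EqQuotient.on localization.
HB.instance Definition _ := Choice.on localization.
Local Notation L := localization.

Definition frac (a : K) (i : nat) : L := \pi_L (a, i).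

Lemma frac_eqP a i b j : frac a i = frac b j <->
  exists k, f ^+ (k + j) * a = f ^+ (k + i) * b.
Proof.
split=> [/eqP|]; first by rewrite piE => /loc_eqP.
by move=> H; apply/eqP; rewrite piE; apply/loc_eqP.
Qed.

Lemma fracW (P : L -> Prop) : (forall a i, P (frac a i)) -> forall x : L, P x.
Proof. by move=> H; elim/quotW => -[a i]; apply: H. Qed.

Definition loc_add (x y : L) : L :=
  let: (a, i) := repr x in let: (b, j) := repr y in
  frac (f ^+ j * a + f ^+ i * b) (i + j).
Definition loc_opp (x : L) : L := let: (a, i) := repr x in frac (- a) i.
Definition loc_mul (x y : L) : L :=
  let: (a, i) := repr x in let: (b, j) := repr y in frac (a * b) (i + j).

Variant repr_frac_spec a i : K * nat -> Prop :=
  ReprFrac b j of (exists k, f ^+ (k + j) * a = f ^+ (k + i) * b) :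
    repr_frac_spec a i (b, j).

Lemma repr_fracP a i : repr_frac_spec a i (repr (frac a i)).
Proof.
case E: (repr _) => [b j]; constructor; apply/frac_eqP.
by rewrite /frac -E reprK.
Qed.

Lemma loc_addE a i b j :
  loc_add (frac a i) (frac b j) = frac (f ^+ j * a + f ^+ i * b) (i + j).
Proof.
rewrite /loc_add; case: repr_fracP => a' i' [k kP].
case: repr_fracP => b' j' [l lP]; apply/frac_eqP; exists (k + l)%N.
move: kP lP; rewrite !exprD => kP lP.
apply: (eq_lincomb (x := - (f ^+ l * f ^+ j * f ^+ j'))
                   (y := - (f ^+ k * f ^+ i * f ^+ i')) kP lP); ring.
Qed.

Lemma loc_oppE a i : loc_opp (frac a i) = frac (- a) i.
Proof.
rewrite /loc_opp; case: repr_fracP => a' i' [k kP]; apply/frac_eqP.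
by exists k; rewrite !mulrN kP.
Qed.

Lemma loc_mulE a i b j :
  loc_mul (frac a i) (frac b j) = frac (a * b) (i + j).
Proof.
rewrite /loc_mul; case: repr_fracP => a' i' [k kP].
case: repr_fracP => b' j' [l lP]; apply/frac_eqP; exists (k + l)%N.
move: kP lP; rewrite !exprD => kP lP.
apply: (eq_lincomb (x := - (f ^+ l * f ^+ j * b'))
                   (y := - (f ^+ k * f ^+ i' * a)) kP lP); ring.
Qed.

Lemma frac_eq a i b j : f ^+ j * a = f ^+ i * b -> frac a i = frac b j.
Proof. by move=> H; apply/frac_eqP; exists 0%N. Qed.

Fact loc_addA : associative loc_add.
Proof.
elim/fracW=> a i; elim/fracW=> b j; elim/fracW=> c k.
by rewrite !loc_addE; apply: frac_eq; rewrite !exprD; ring.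
Qed.
Fact loc_addC : commutative loc_add.
Proof.
elim/fracW=> a i; elim/fracW=> b j.
by rewrite !loc_addE addrC addnC.
Qed.
Fact loc_add0 : left_id (frac 0 0) loc_add.
Proof.
by elim/fracW=> a i; rewrite loc_addE expr0 mulr0 add0r mul1r add0n.
Qed.
Fact loc_addN : left_inverse (frac 0 0) loc_opp loc_add.
Proof.
by elim/fracW=> a i; rewrite loc_oppE loc_addE; apply: frac_eq; ring.
Qed.
HB.instance Definition _ :=
  GRing.isZmodule.Build localization loc_addA loc_addC loc_add0 loc_addN.

Fact loc_mulA : associative loc_mul.
Proof.
elim/fracW=> a i; elim/fracW=> b j; elim/fracW=> c k.
by rewrite !loc_mulE mulrA addnA.
Qed.
Fact loc_mulC : commutative loc_mul.
Proof.
elim/fracW=> a i; elim/fracW=> b j.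
by rewrite !loc_mulE mulrC addnC.
Qed.
Fact loc_mul1 : left_id (frac 1 0) loc_mul.
Proof. by elim/fracW=> a i; rewrite loc_mulE mul1r add0n. Qed.
Fact loc_mulDl : left_distributive loc_mul loc_add.
Proof.
elim/fracW=> a i; elim/fracW=> b j; elim/fracW=> c k.
rewrite !(loc_addE, loc_mulE); apply: frac_eq; rewrite !exprD; ring.
Qed.
HB.instance Definition _ := GRing.Zmodule_isComPzRing.Build localization
  loc_mulA loc_mulC loc_mul1 loc_mulDl.

Definition loc_of (a : K) : localization := frac a 0.

Lemma loc_of_zmod : zmod_morphism loc_of.
Proof.
move=> a b; apply/esym.
change (loc_add (frac a 0) (loc_opp (frac b 0)) = frac (a - b) 0).
by rewrite loc_oppE loc_addE !expr0 !mul1r.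
Qed.
Lemma loc_of_monoid : monoid_morphism loc_of.
Proof. by split=> // a b; apply/esym; apply: loc_mulE. Qed.
HB.instance Definition _ :=
  GRing.isZmodMorphism.Build K localization loc_of loc_of_zmod.
HB.instance Definition _ :=
  GRing.isMonoidMorphism.Build K localization loc_of loc_of_monoid.

End Localization.

Section LocalizationMap.
Variables (K K' : comPzRingType) (phi : {rmorphism K -> K'}) (f : K).

Definition loc_map (x : localization f) : localization (phi f) :=
  let: (a, i) := repr x in frac (phi f) (phi a) i.

Lemma loc_mapE a i : loc_map (frac f a i) = frac (phi f) (phi a) i.
Proof.
rewrite /loc_map; case: repr_fracP => b j [k kP]; apply/frac_eqP.
by exists k; rewrite -!rmorphXn -!rmorphM kP.
Qed.

Lemma loc_map_zmod : zmod_morphism loc_map.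
Proof.
elim/fracW=> a i; elim/fracW=> b j.
change (loc_map (loc_add (frac f a i) (loc_opp (frac f b j))) =
  loc_add (loc_map (frac f a i)) (loc_opp (loc_map (frac f b j)))).
rewrite loc_oppE loc_addE !loc_mapE loc_oppE loc_addE.
by rewrite rmorphD !rmorphM rmorphN !rmorphXn.
Qed.
Lemma loc_map_monoid : monoid_morphism loc_map.
Proof.
split; first by rewrite (loc_mapE 1 0) rmorph1.
elim/fracW=> a i; elim/fracW=> b j.
change (loc_map (loc_mul (frac f a i) (frac f b j)) =
  loc_mul (loc_map (frac f a i)) (loc_map (frac f b j))).
by rewrite loc_mulE !loc_mapE loc_mulE rmorphM.
Qed.
HB.instance Definition _ := GRing.isZmodMorphism.Build
  (localization f) (localization (phi f)) loc_map loc_map_zmod.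
HB.instance Definition _ := GRing.isMonoidMorphism.Build
  (localization f) (localization (phi f)) loc_map loc_map_monoid.

End LocalizationMap.

Section AdicCompletion.
Variables (K : comPzRingType) (p : K).

Definition level (N : nat) := quot_ideal (fun x : K => x = p ^+ N).

Lemma level_eqP (N : nat) (x y : K) :
  quot_pi _ x = quot_pi _ y :> level N <-> exists c, x - y = c * p ^+ N.
Proof.
split=> [/quot_idealP[s sP ->]|[c xy]].
  exists (\sum_(q <- s) q.1); rewrite mulr_suml !big_seq.
  by apply: eq_bigr => q /sP ->.
apply/quot_idealP; rewrite xy.
by have [_ _ IM] := ideal_genP (fun x : K => x = p ^+ N); apply/IM/mem_ideal_gen.
Qed.

Definition adic_seq := forall N, level N.
HB.instance Definition _ := Choice.copy adic_seq (forall N, level N).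

Fact adic_seq_addA : associative (fun (x y : adic_seq) N => x N + y N).
Proof. by move=> x y z; apply/functional_extensionality_dep => N; rewrite addrA. Qed.
Fact adic_seq_addC : commutative (fun (x y : adic_seq) N => x N + y N).
Proof. by move=> x y; apply/functional_extensionality_dep => N; rewrite addrC. Qed.
Fact adic_seq_add0 :
  left_id (fun _ => 0) (fun (x y : adic_seq) N => x N + y N).
Proof. by move=> x; apply/functional_extensionality_dep => N; rewrite add0r. Qed.
Fact adic_seq_addN : left_inverse (fun N => 0) (fun (x : adic_seq) N => - x N)
  (fun (x y : adic_seq) N => x N + y N).
Proof. by move=> x; apply/functional_extensionality_dep => N; rewrite addNr. Qed.
HB.instance Definition _ := GRing.isZmodule.Build adic_seq
  adic_seq_addA adic_seq_addC adic_seq_add0 adic_seq_addN.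

Fact adic_seq_mulA : associative (fun (x y : adic_seq) N => x N * y N).
Proof. by move=> x y z; apply/functional_extensionality_dep => N; rewrite mulrA. Qed.
Fact adic_seq_mulC : commutative (fun (x y : adic_seq) N => x N * y N).
Proof. by move=> x y; apply/functional_extensionality_dep => N; rewrite mulrC. Qed.
Fact adic_seq_mul1 :
  left_id (fun N => 1) (fun (x y : adic_seq) N => x N * y N).
Proof. by move=> x; apply/functional_extensionality_dep => N; rewrite mul1r. Qed.
Fact adic_seq_mulDl : left_distributive
  (fun (x y : adic_seq) N => x N * y N) (fun (x y : adic_seq) N => x N + y N).
Proof. by move=> x y z; apply/functional_extensionality_dep => N; rewrite mulrDl. Qed.
HB.instance Definition _ := GRing.Zmodule_isComPzRing.Build adic_seq
  adic_seq_mulA adic_seq_mulC adic_seq_mul1 adic_seq_mulDl.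

(* Sequences compatible with the transition maps K/p^(N+1) -> K/p^N. *)
Definition adic_compat : {pred adic_seq} := fun x => `[< forall N,
  exists a : K, x N = quot_pi _ a /\ x N.+1 = quot_pi _ a >].

Fact adic_compat_subring : subring_closed adic_compat.
Proof.
split=> [|x y /asboolP Cx /asboolP Cy|x y /asboolP Cx /asboolP Cy];
  apply/asboolP => N; first by exists 1.
- have [[a [a0 a1]] [b [b0 b1]]] := (Cx N, Cy N); exists (a - b).
  change (x N - y N = quot_pi _ (a - b) /\ x N.+1 - y N.+1 = quot_pi _ (a - b)).
  by rewrite a0 a1 b0 b1 !rmorphB.
- have [[a [a0 a1]] [b [b0 b1]]] := (Cx N, Cy N); exists (a * b).
  change (x N * y N = quot_pi _ (a * b) /\ x N.+1 * y N.+1 = quot_pi _ (a * b)).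
  by rewrite a0 a1 b0 b1 !rmorphM.
Qed.
HB.instance Definition _ :=
  GRing.isSubringClosed.Build adic_seq adic_compat adic_compat_subring.

(* The p-adic completion, i.e. the inverse limit of the rings K/p^N. *)
Record adic_completion := AdicCompletion {
  adic_val :> adic_seq;
  adic_valP : adic_val \in adic_compat }.
HB.instance Definition _ := [isSub for adic_val].
HB.instance Definition _ := [Choice of adic_completion by <:].
HB.instance Definition _ := GRing.SubChoice_isSubComPzRing.Build
  adic_seq (mem adic_compat) adic_completion adic_compat_subring.


Fact adic_of_subproof (a : K) :
  ((fun N => quot_pi _ a) : adic_seq) \in adic_compat.
Proof. by apply/asboolP => N; exists a. Qed.
Definition adic_of (a : K) : adic_completion :=
  AdicCompletion (adic_of_subproof a).

Lemma adic_of_zmod : zmod_morphism adic_of.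
Proof.
move=> a b; apply/val_inj/functional_extensionality_dep => N.
exact: (rmorphB (quot_pi (fun x : K => x = p ^+ N))).
Qed.
Lemma adic_of_monoid : monoid_morphism adic_of.
Proof.
split=> [|a b]; apply/val_inj/functional_extensionality_dep => N //.
exact: (rmorphM (quot_pi (fun x : K => x = p ^+ N))).
Qed.
HB.instance Definition _ :=
  GRing.isZmodMorphism.Build K adic_completion adic_of adic_of_zmod.
HB.instance Definition _ :=
  GRing.isMonoidMorphism.Build K adic_completion adic_of adic_of_monoid.

End AdicCompletion.

Section AdicMap.
Variables (K K' : comPzRingType) (phi : {rmorphism K -> K'}) (p : K) (p' : K').
Hypothesis phi_p : phi p = p'.

Definition adic_seq_map (x : adic_seq p) : adic_seq p' :=
  fun N => quot_pi _ (phi (repr (x N))).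

Lemma adic_seq_mapE (x : adic_seq p) N a :
  x N = quot_pi _ a -> adic_seq_map x N = quot_pi _ (phi a).
Proof.
move=> xa; apply/level_eqP; have: quot_pi _ (repr (x N)) = x N by exact: reprK.
rewrite {2}xa => /level_eqP[c cP]; exists (phi c).
by rewrite -phi_p -rmorphXn -rmorphM -rmorphB cP.
Qed.

Fact adic_map_subproof (x : adic_completion p) :
  adic_seq_map x \in @adic_compat K' p'.
Proof.
apply/asboolP => N; have /asboolP/(_ N)[a [a0 a1]] := adic_valP x.
by exists (phi a); split; apply: adic_seq_mapE.
Qed.

Definition adic_map (x : adic_completion p) : adic_completion p' :=
  AdicCompletion (adic_map_subproof x).

Lemma adic_repr (x : adic_seq p) N : exists a, x N = quot_pi _ a.
Proof. by exists (repr (x N)); apply/esym/reprK. Qed.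

Lemma adic_map_zmod : zmod_morphism adic_map.
Proof.
move=> x y; apply/val_inj/functional_extensionality_dep => N.
have [[a aP] [b bP]] := (adic_repr x N, adic_repr y N).
have E : \val (x - y) = \val x - \val y by exact: (rmorphB \val).
change (adic_seq_map (\val (x - y)) N = adic_seq_map x N - adic_seq_map y N).
rewrite E (adic_seq_mapE aP) (adic_seq_mapE bP) -!rmorphB.
apply/adic_seq_mapE/(etrans (congr2 (fun u v : level p N => u - v) aP bP)).
exact/esym/rmorphB.
Qed.
Lemma adic_map_monoid : monoid_morphism adic_map.
Proof.
split=> [|x y]; apply/val_inj/functional_extensionality_dep => N.
  change (adic_seq_map (fun N => quot_pi _ 1) N = quot_pi _ 1).
  by rewrite (@adic_seq_mapE _ _ 1) // rmorph1.
have [[a aP] [b bP]] := (adic_repr x N, adic_repr y N).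
have E : \val (x * y) = \val x * \val y by exact: (rmorphM \val).
change (adic_seq_map (\val (x * y)) N = adic_seq_map x N * adic_seq_map y N).
rewrite E (adic_seq_mapE aP) (adic_seq_mapE bP) -!rmorphM.
apply/adic_seq_mapE/(etrans (congr2 (fun u v : level p N => u * v) aP bP)).
exact/esym/rmorphM.
Qed.
HB.instance Definition _ := GRing.isZmodMorphism.Build
  (adic_completion p) (adic_completion p') adic_map adic_map_zmod.
HB.instance Definition _ := GRing.isMonoidMorphism.Build
  (adic_completion p) (adic_completion p') adic_map adic_map_monoid.

End AdicMap.

Section CompletedLocalization.
Variables (K : comPzRingType) (p f : K).

(* K[1/f]^, completed p-adically: for K = A^p with the p-adic topology, this is
   the ring of functions on the open formal subscheme of Spf K where f does not
   vanish. *)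
Definition loc_completion := adic_completion (loc_of f p).
HB.instance Definition _ := GRing.ComPzRing.on loc_completion.

Definition loc_completion_of (a : K) : loc_completion :=
  adic_of (loc_of f p) (loc_of f a).
HB.instance Definition _ := GRing.RMorphism.copy loc_completion_of
  (adic_of (loc_of f p) \o loc_of f).

End CompletedLocalization.

Section CompletedLocalizationMap.
Variables (K K' : comPzRingType) (phi : {rmorphism K -> K'}) (p f : K).

Definition loc_completion_map :
    loc_completion p f -> loc_completion (phi p) (phi f) :=
  adic_map (loc_mapE phi f p 0).
HB.instance Definition _ := GRing.RMorphism.copy loc_completion_map
  (adic_map (loc_mapE phi f p 0)).

Lemma loc_completion_map_of (a : K) :
  loc_completion_map (loc_completion_of p f a) =
  loc_completion_of (phi p) (phi f) (phi a).
Proof.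
apply/val_inj/functional_extensionality_dep => N.
apply: etrans (adic_seq_mapE (phi := loc_map phi (f := f))
  (x := fun N => quot_pi _ (loc_of f a)) (loc_mapE phi f p 0)
  (erefl (quot_pi _ (loc_of f a)))) _.
by rewrite /= /loc_of loc_mapE.
Qed.

End CompletedLocalizationMap.

Section RestrictedPowerSeries.
Variables (n : nat) (K : comPzRingType) (I : K -> Prop).

(* The coefficients tend to 0 in the I-adic topology of K. *)
Definition restricted : {pred mpseries n K} := fun f => `[< forall N,
  exists D, forall m, (D <= mdeg m)%N -> ideal_exp I N (f m) >].

Fact restrictedC (c : K) : mpsC n c \in restricted.
Proof.
apply/asboolP => N; exists 1%N => m; rewrite lt0n mdeg_eq0 => /negPf m0.
by rewrite /mpsC m0; case: (ideal_genP (fun x => exists2 y : 'I_N -> K,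
  (forall i, I (y i)) & x = \prod_(i < N) y i)).
Qed.

Fact restrictedX (i : 'I_n) : mpsX K i \in restricted.
Proof.
apply/asboolP => N; exists 2%N => m m2; rewrite /mpsX.
case: eqP m2 => [->|_ _]; first by rewrite mdeg1.
by case: (ideal_genP (fun x => exists2 y : 'I_N -> K,
  (forall i, I (y i)) & x = \prod_(i < N) y i)).
Qed.

Fact restricted_subring : subring_closed restricted.
Proof.
split=> [|f g /asboolP rf /asboolP rg|f g /asboolP rf /asboolP rg].
- exact: restrictedC.
- apply/asboolP => N; have [[D DP] [E EP]] := (rf N, rg N).
  have [I0 ID IM] : is_ideal (ideal_exp I N) by exact: ideal_genP.
  exists (maxn D E) => m; rewrite geq_max => /andP[Dm Em].
  change (ideal_exp I N (f m - g m)); apply: ID; first exact: DP.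
  by rewrite -mulN1r; apply/IM/EP.
- apply/asboolP => N; have [[D DP] [E EP]] := (rf N, rg N).
  have [I0 ID IM] : is_ideal (ideal_exp I N) by exact: ideal_genP.
  exists (D + E)%N => m DEm; rewrite /GRing.mul /= /mps_mul.
  elim/big_ind: _ => // k /submK mE.
  case: (leqP D (mdeg k)) => [Dk|kD]; first by rewrite mulrC; apply/IM/DP.
  apply/IM/EP; rewrite -(leq_add2l (mdeg k)) addnC [leqRHS]addnC -mdegD mE.
  by apply: leq_trans DEm; rewrite addnC leq_add2r ltnW.
Qed.
HB.instance Definition _ :=
  GRing.isSubringClosed.Build (mpseries n K) restricted restricted_subring.

(* K<T_1, ..., T_n>, for the I-adic topology on K. *)
Record rpseries := RPSeries {
  rps_val :> mpseries n K;
  rps_valP : rps_val \in restricted }.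
HB.instance Definition _ := [isSub for rps_val].
HB.instance Definition _ := [Choice of rpseries by <:].
HB.instance Definition _ := GRing.SubChoice_isSubComPzRing.Build
  (mpseries n K) (mem restricted) rpseries restricted_subring.

Definition rpsC (c : K) : rpseries := RPSeries (restrictedC c).
Definition rpsX (i : 'I_n) : rpseries := RPSeries (restrictedX i).

Lemma rpsC_zmod : zmod_morphism rpsC.
Proof.
move=> a b; apply: val_inj; rewrite (rmorphB \val).
exact: (rmorphB (@mpsC n K)).
Qed.
Lemma rpsC_monoid : monoid_morphism rpsC.
Proof.
split=> [|a b]; apply: val_inj; first by rewrite (rmorph1 \val).
rewrite (rmorphM \val); exact: (rmorphM (@mpsC n K)).
Qed.
HB.instance Definition _ := GRing.isZmodMorphism.Build K rpseries rpsC rpsC_zmod.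
HB.instance Definition _ :=
  GRing.isMonoidMorphism.Build K rpseries rpsC rpsC_monoid.

End RestrictedPowerSeries.

Section CompleteDVR.
Variables (R : idomainType) (pi : R).

(* R is a local principal ideal domain, not a field, whose maximal ideal is
   generated by pi. *)
Definition dvr_uniformizer : Prop :=
  [/\ forall I : R -> Prop, is_ideal I ->
        exists a, forall x, I x <-> exists c, x = c * a,
      forall x, x \isn't a GRing.unit <-> exists c, x = c * pi &
      pi != 0].

Definition complete_dvr : Prop := dvr_uniformizer /\ bijective (adic_of pi).

End CompleteDVR.

(* The variables of R[[S_1, ..., S_n, Z]] are indexed by 'I_n.+1: S_1, ..., S_n
   come first and the last one, ord_max, is Z. *)
Section Distinguished.
Variables (n : nat) (R : comPzRingType) (pi : R).

Definition varS (i : 'I_n) : mpseries n.+1 R :=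
  mpsX R (widen_ord (leqnSn n) i).

Definition residue := quot_ideal (fun x => x = pi).
HB.instance Definition _ := GRing.ComPzRing.on residue.

(* R[[S_1, ..., S_n, Z]] -> k[[Z]] *)
Definition reduction (f : mpseries n.+1 R) : mpseries 1 residue :=
  fun m => quot_pi _ (f (U_(ord_max) *+ m ord0)%MM).

Lemma reduction_zmod : zmod_morphism reduction.
Proof. by move=> f g; apply/funext => m; apply: (rmorphB (quot_pi _)). Qed.

Lemma reduction_monoid : monoid_morphism reduction.
Proof.
split=> [|f g]; apply/funext => m; rewrite /reduction.
  have -> : 1%R = mpsC n.+1 1 :> mpseries n.+1 R by [].
  have -> : 1%R = mpsC 1 1 :> mpseries 1 residue by [].
  rewrite /mpsC; have -> : ((U_(ord_max) *+ m ord0)%MM == 0%MM :> 'X_{1..n.+1})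
      = (m == 0%MM).
    rewrite -!mdeg_eq0 mdegMn mdeg1 mul1n mdegE big_ord1 //.
  by case: eqP => _; rewrite ?rmorph1 ?rmorph0.
set z := fun d => (U_(ord_max) *+ d)%MM : 'X_{1..n.+1}.
have degz d : mdeg (z d) = d by rewrite mdegMn mdeg1 mul1n.
have deg1 (k : 'X_{1..1}) : mdeg k = k ord0 by rewrite mdegE big_ord1.
have zle (k : 'X_{1..n.+1}) d : (k <= z d)%MM -> k = z (k ord_max).
  move=> /mnm_lepP kz; apply/mnmP => i; rewrite mulmnE mnm1E.
  case: eqP => [<-|/eqP ni]; first by rewrite mul1n.
  by move: (kz i); rewrite mulmnE mnm1E (negPf ni) mul0n leqn0 => /eqP.
set b := (m ord0).+1; change (quot_pi (fun x => x = pi) (mps_mul f g (z (m ord0))) =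
  mps_mul (reduction f) (reduction g) m).
rewrite (@mps_mulE _ _ b) ?degz // (@mps_mulE _ _ b) ?deg1 // rmorph_sum /=.
have hP (k : 'X_{1..1 < b}) : (mdeg (z (k ord0)) < b)%N.
  by rewrite degz -deg1 bmdeg.
have hP' (k : 'X_{1..n.+1 < b}) :
    (mdeg ([multinom k ord_max | i < 1] : 'X_{1..1}) < b)%N.
  rewrite deg1 mnmE (leq_ltn_trans _ (bmdeg k)) // mdegE (bigD1 ord_max) //=.
  exact: leq_addr.
rewrite (reindex_onto (fun k => BMultinom (hP k)) (fun k => BMultinom (hP' k)));
  last by move=> k /zle kz; apply: val_inj; rewrite /= mnmE -kz.
apply: eq_big => [k|k /andP[/= kz _]] /=.
  have -> : (BMultinom (hP' (BMultinom (hP k))) == k) = true.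
    apply/eqP/val_inj/mnmP => i /=; rewrite mnmE mulmnE mnm1E eqxx mul1n.
    by rewrite (ord1 i).
  rewrite andbT; apply/mnm_lepP/mnm_lepP => [H i|H i].
    by move: (H ord_max); rewrite !mulmnE !mnm1E eqxx !mul1n (ord1 i).
  by rewrite !mulmnE leq_mul2l H orbT.
rewrite rmorphM; congr (_ * quot_pi _ (g _)).
by apply/mnmP => i; rewrite mnmBE !mulmnE mnmBE mulnBr.
Qed.
HB.instance Definition _ := GRing.isZmodMorphism.Build
  (mpseries n.+1 R) (mpseries 1 residue) reduction reduction_zmod.
HB.instance Definition _ := GRing.isMonoidMorphism.Build
  (mpseries n.+1 R) (mpseries 1 residue) reduction reduction_monoid.

Definition Z_distinguished (f : mpseries n.+1 R) : Prop :=
  reduction f <> 0 /\ ~ exists u, u * reduction f = 1.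

End Distinguished.

Section Blowup.
Variables (n r : nat) (R : comPzRingType) (pi : R).

(* O(X) = R[[S_1, ..., S_n, Z]].  It is also the ring of global functions of
   the R-envelope X_pi, which only replaces the topology by the pi-adic one;
   likewise for O(X') below. *)
Definition OX := mpseries n.+1 R.
HB.instance Definition _ := GRing.ComPzRing.on OX.

Definition piX : OX := mpsC n.+1 pi.
Definition adic_ideal : OX -> Prop :=
  ideal_gen (fun x => x = piX \/ exists i, x = mpsX R i).

(* O(X)<T_1, ..., T_n>, for the (pi, S_1, ..., S_n, Z)-adic topology. *)
Definition OXT := rpseries n adic_ideal.
HB.instance Definition _ := GRing.ComPzRing.on OXT.

Definition blowup_rel (x : OXT) : Prop := exists j : 'I_n,
  x = rpsC n adic_ideal piX ^+ r.+1 * rpsX adic_ideal j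
      - rpsC n adic_ideal (varS R j).

(* O(X'), where X' is the chart of the blowup of (pi^(r+1), S_1, ..., S_n) on
   which pi^(r+1) generates the pulled back ideal; T_j is S_j / pi^(r+1). *)
Definition OX' := quot_ideal blowup_rel.
HB.instance Definition _ := GRing.ComPzRing.on OX'.

Definition blowup : OX -> OX' := quot_pi blowup_rel \o rpsC n adic_ideal.
HB.instance Definition _ := GRing.RMorphism.on blowup.

End Blowup.

Arguments piX n {R} pi.
Arguments OX' n r {R} pi.
Arguments blowup n r {R} pi _.

(* Main.v *)
Require Import Defs.
From HB Require Import structures.
From mathcomp Require Import all_boot all_order all_algebra.
From mathcomp Require Import boolp ssrcomplements mpoly.
From mathcomp Require Import ring zify.

Set Implicit Arguments.
Unset Strict Implicit.
Unset Printing Implicit Defensive.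

Import GRing.Theory.
Local Open Scope ring_scope.

Local Notation frac := Defs.frac.

(** Write A = R[[S,Z]], q = pi^(r+1).  Substituting q T_j for S_j embeds
    O(X') = A<T>/(q T_j - S_j) into R[[T,Z]]: the S_j are eliminated one after the
    other, and the quotients stay restricted because q is divisible by pi.
    There an element of A is a series whose coefficient at T^m Z^i is divisible by
    q^|m|, and f is, modulo pi, Z^d times a unit.

    Modulo pi^N write g = a_N / f^k.  Then f^k h = a_N modulo pi^N, so that the
    coefficients of f^k h at T^m Z^i are divisible by pi^min(N, (r+1)|m|).  By a
    Gauss lemma f^k may be cancelled, and letting N grow shows that h comes from
    some a in A.  Next, u_N = a_N - f^k a vanishes modulo pi^N in R[[T,Z]], i.e.
    its coefficients at S^m Z^i are divisible by pi^(N - (r+1)|m|).  For M large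
    with respect to N and |m|, a power of f times u_N is congruent modulo pi^N to
    a power of f times u_M, and cancelling powers of f again shows that u_N is
    divisible by pi^N, so that g is the image of a. *)

(** * Divisibility by powers of an element *)

Section PowerDivisibility.
Variables (K : comPzRingType) (p : K).

Definition dvdX (e : nat) (x : K) : Prop := exists c, x = c * p ^+ e.

Lemma dvdX0 e : dvdX e 0.
Proof. by exists 0; rewrite mul0r. Qed.

Lemma dvd0X x : dvdX 0 x.
Proof. by exists x; rewrite mulr1. Qed.

Lemma dvdXD e x y : dvdX e x -> dvdX e y -> dvdX e (x + y).
Proof. by move=> [a ->] [b ->]; exists (a + b); rewrite mulrDl. Qed.

Lemma dvdXM d e x y : dvdX d x -> dvdX e y -> dvdX (d + e) (x * y).
Proof. by move=> [a ->] [b ->]; exists (a * b); rewrite exprD mulrACA. Qed.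

Lemma dvdXW d e x : (d <= e)%N -> dvdX e x -> dvdX d x.
Proof.
by move=> de [a ->]; exists (a * p ^+ (e - d)); rewrite -mulrA -exprD subnK.
Qed.

Lemma dvdXMl e x y : dvdX e y -> dvdX e (x * y).
Proof. by move=> [b ->]; exists (x * b); rewrite mulrA. Qed.

Lemma dvdXMr e x y : dvdX e x -> dvdX e (x * y).
Proof. by rewrite mulrC; apply: dvdXMl. Qed.

Lemma dvdXN e x : dvdX e x -> dvdX e (- x).
Proof. by rewrite -mulN1r; apply: dvdXMl. Qed.

Lemma dvdXB e x y : dvdX e x -> dvdX e y -> dvdX e (x - y).
Proof. by move=> ex ey; apply/dvdXD/dvdXN. Qed.

Lemma dvdX_sum e (I : Type) (s : seq I) (P : pred I) (F : I -> K) :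
  (forall i, P i -> dvdX e (F i)) -> dvdX e (\sum_(i <- s | P i) F i).
Proof.
by move=> eF; apply: big_ind => //; [apply: dvdX0 | apply: dvdXD].
Qed.

End PowerDivisibility.

(** * Coefficients of multivariate power series *)

Section Coefficients.
Variables (n : nat) (K : comPzRingType).
Implicit Types (a b : mpseries n K) (m k : 'X_{1..n}).

Lemma mps_coefB a b m : (a - b) m = a m - b m. Proof. by []. Qed.

Lemma mps_coefD a b m : (a + b) m = a m + b m. Proof. by []. Qed.

Lemma mps_coefM a b m :
  (a * b) m = \sum_(k : 'X_{1..n < (mdeg m).+1} | (k <= m)%MM) a k * b (m - k)%MM.
Proof. by []. Qed.

Lemma mps_coefCM c a m : (mpsC n c * a) m = c * a m.
Proof. exact: mpsC_mulE. Qed.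

Lemma mps_coef1 m : (1 : mpseries n K) m = (m == 0%MM)%:R.
Proof. by rewrite -[1]/(mpsC n 1) /mpsC; case: eqP. Qed.

Lemma mps_coef_sum (I : Type) (s : seq I) (P : pred I) (F : I -> mpseries n K) m :
  (\sum_(i <- s | P i) F i) m = \sum_(i <- s | P i) F i m.
Proof. by elim/big_rec2: _ => // i y x _ <-. Qed.

Definition mps_mono k : mpseries n K := fun m => (m == k)%:R.

Lemma mps_coef_monoM k a m :
  (mps_mono k * a) m = if (k <= m)%MM then a (m - k)%MM else 0.
Proof.
rewrite mps_coefM; case: ifP => km.
  have dk : (mdeg k < (mdeg m).+1)%N by rewrite ltnS -(submK km) mdegD leq_addl.
  rewrite (bigD1 (BMultinom dk)) //= big1 => [|l /andP[_ lk]].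
    by rewrite /mps_mono eqxx mul1r addr0.
  by rewrite /mps_mono (_ : (l == k :> 'X_{1..n}) = false) ?mul0r //; apply: negPf lk.
by apply: big1 => l lm; rewrite /mps_mono; case: eqP lm => [->|]; rewrite ?km ?mul0r.
Qed.

Lemma mps_coefXM i a m :
  (mpsX K i * a) m = if (0 < m i)%N then a (m - U_(i))%MM else 0.
Proof. by rewrite (mps_coef_monoM U_(i)) lep1mP lt0n. Qed.

Lemma mps_mono0 : mps_mono 0 = 1.
Proof. by apply/funext => m; rewrite mps_coef1. Qed.

Lemma mps_monoD k l : mps_mono (k + l) = mps_mono k * mps_mono l.
Proof.
apply/funext => m; rewrite mps_coef_monoM /mps_mono; case: ifP => km.
  congr (nat_of_bool _)%:R; apply/eqP/eqP => [->|<-]; first by rewrite addmC addmK.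
  by rewrite addmC submK.
by case: eqP km => // ->; rewrite lem_addr.
Qed.

Lemma mps_dvd p e a : (forall m, dvdX p e (a m)) -> exists b, a = b * mpsC n p ^+ e.
Proof.
move=> /choice[b bP]; exists b; apply/funext => m.
by rewrite -rmorphXn /= mulrC mps_coefCM mulrC -bP.
Qed.

Lemma mps_dvd_coef p e a m : dvdX (mpsC n p) e a -> dvdX p e (a m).
Proof.
by move=> [b ->]; exists (b m); rewrite -rmorphXn /= mulrC mps_coefCM mulrC.
Qed.

End Coefficients.

Arguments mps_mono {n K} k.

(** * The degree in the variables [S_j] *)

Section SDegree.
Variable n : nat.
Implicit Types (m k : 'X_{1..n.+1}).

Local Notation wid := (widen_ord (leqnSn n)).

Definition sdeg m : nat := \sum_(i < n) m (wid i).

Lemma sdegD m k : sdeg (m + k)%MM = (sdeg m + sdeg k)%N.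
Proof. by rewrite /sdeg -big_split; apply: eq_bigr => i _; rewrite /= mnmDE. Qed.

Lemma sdegB m k : (k <= m)%MM -> (sdeg (m - k)%MM + sdeg k)%N = sdeg m.
Proof. by move=> km; rewrite -sdegD submK. Qed.

Lemma wid_neq_max (i : 'I_n) : (wid i == ord_max) = false.
Proof. by apply/negbTE; rewrite -val_eqE /= ltn_eqF. Qed.

Lemma wid_inj : injective wid.
Proof. by move=> i j /(congr1 val) ij; apply: val_inj. Qed.

Lemma ord_wid (P : 'I_n.+1 -> Prop) :
  (forall i, P (wid i)) -> P ord_max -> forall i, P i.
Proof.
move=> Pw Pm i; case: (unliftP ord_max i) => [j|] ->; last exact: Pm.
have -> : lift ord_max j = wid j by apply: val_inj; rewrite /= /bump leqNgt ltn_ord.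
exact: Pw.
Qed.

Definition monZ d : 'X_{1..n.+1} := (U_(ord_max) *+ d)%MM.

Lemma monZ_max d : monZ d ord_max = d.
Proof. by rewrite mulmnE mnm1E eqxx mul1n. Qed.

Lemma monZ_wid d i : monZ d (wid i) = 0%N.
Proof. by rewrite mulmnE mnm1E eq_sym wid_neq_max. Qed.

Lemma sdeg_monZ d : sdeg (monZ d) = 0%N.
Proof. by rewrite /sdeg big1 // => i _; rewrite monZ_wid. Qed.

Lemma sdeg_eq0 m : sdeg m = 0%N -> m = monZ (m ord_max).
Proof.
move/eqP; rewrite /sdeg sum_nat_eq0 => /forallP m0.
apply/mnmP; elim/ord_wid => [i|]; last by rewrite monZ_max.
by rewrite monZ_wid; apply/eqP/(implyP (m0 i)).
Qed.

Lemma sdeg_wid_eq0 m : (forall i, m (wid i) = 0%N) -> sdeg m = 0%N.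
Proof. by move=> m0; apply: big1 => i _. Qed.

Lemma mdeg_mnmwiden (k : 'X_{1..n}) : mdeg (mnmwiden k) = mdeg k.
Proof.
rewrite mdegE big_ord_recr /= mnmwiden_ordmax addn0 mdegE.
by apply: eq_bigr => i _; rewrite mnmwiden_widen.
Qed.

End SDegree.

(** * A weighted Gauss lemma *)

Section WeightedCancellation.
Variables (n : nat) (R : comUnitRingType) (p : R) (F : mpseries n.+1 R) (d : nat).
Hypothesis F_unit : F (monZ n d) \is a GRing.unit.
Hypothesis F_low : forall i, (i < d)%N -> dvdX p 1 (F (monZ n i)).
Variables (w : nat -> nat) (N : nat).
Hypothesis w_bound : forall s, (w s <= N)%N.
Hypothesis F_weight : forall m s, dvdX p (w (sdeg m + s) - w s) (F m).

(** As functions of the [S]-degree [s], the weights used below are [N], [min(N, (r+1)s)] and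
    [min(N, M - (r+1)s)]. *)
Definition weighted (h : mpseries n.+1 R) := forall m, dvdX p (w (sdeg m)) (h m).

(* Gauss' lemma.  Let [e] be the largest defect of divisibility of [h].  Among
   the monomials [m] with this defect, take one with least [S]-degree, then least
   [Z]-degree: in the coefficient of [F * h] at [m Z^d] the term
   [F (Z^d) * h m] dominates all the others. *)
Lemma weighted_cancel h : weighted (F * h) -> weighted h.
Proof.
(* Descending induction on the defect [e]: a defect of [N] is always allowed, and [t] counts the
   steps down from [N]. *)
move=> Fh; suff H t : forall e, (N <= t + e)%N -> forall m, dvdX p (w (sdeg m) - e) (h m).
  by move=> m; rewrite -[w _]subn0; apply: (H N); rewrite addn0.
elim: t => [|t IHt] e Nte m.
  by have -> : (w (sdeg m) - e = 0)%N; [have := w_bound (sdeg m); lia | apply: dvd0X].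
have {}IHt m' : dvdX p (w (sdeg m') - e.+1) (h m').
  by apply: IHt; rewrite addnS -addSn.
have [s ms] : exists s, sdeg m = s by exists (sdeg m).
elim/ltn_ind: s m ms => s IHs m.
have [z mz] : exists z, m ord_max = z by exists (m ord_max).
elim/ltn_ind: z m mz => z IHz m mz ms.
pose m' := (m + monZ n d)%MM.
have zm' : (mdeg (monZ n d) < (mdeg m').+1)%N by rewrite ltnS mdegD leq_addl.
have sm' : sdeg m' = sdeg m by rewrite sdegD sdeg_monZ addn0.
have := Fh m'; rewrite mps_coefM (bigD1 (BMultinom zm')) /=; last by rewrite lem_addl.
rewrite addmK sm'; set rest := \sum_(_ | _) _ => Fm.
have restP : dvdX p (w (sdeg m) - e) rest.
  apply: dvdX_sum => k /andP[km' kd].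
  have kS := sdegB km'; rewrite sm' in kS.
  have [sk0|sk0] := posnP (sdeg k).
    have kE := sdeg_eq0 sk0; have sE : sdeg (m' - k)%MM = sdeg m by rewrite -kS sk0 addn0.
    (* Below [d], the factor [p] in [F] makes up for a defect of [e+1]; above [d], the cofactor has
       smaller [Z]-degree; [d] itself is the term already split off. *)
    have [kd'|dk|E] := ltngtP (k ord_max) d.
    - rewrite kE; apply: (@dvdXW _ _ _ (1 + (w (sdeg m) - e.+1))); first lia.
      by apply: dvdXM; [apply: F_low | rewrite -kE -sE; apply: IHt].
    - apply: dvdXMl; rewrite -sE.
      apply: (IHz ((m' - k)%MM ord_max)) => //; last by rewrite sE.
      move: km' => /mnm_lepP/(_ ord_max); rewrite mnmBE mnmDE monZ_max -mz; lia.
    - by move: kd; rewrite -val_eqE /= kE E eqxx.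
  (* The cofactor has smaller [S]-degree, hence defect at most [e], and [F_weight] supplies the
     missing power of [p]. *)
  apply: (@dvdXW _ _ _ ((w (sdeg k + sdeg (m' - k)%MM) - w (sdeg (m' - k)%MM))
      + (w (sdeg (m' - k)%MM) - e))).
    by rewrite addnC in kS; rewrite kS; lia.
  by apply: dvdXM => //; apply: (IHs (sdeg (m' - k)%MM)) => //; lia.
have -> : h m = (F (monZ n d))^-1 * (F (monZ n d) * h m + rest - rest).
  by rewrite addrK mulKr.
by apply/dvdXMl/dvdXB => //; apply: dvdXW Fm; lia.
Qed.

Lemma weighted_cancelX k h : weighted (F ^+ k * h) -> weighted h.
Proof.
elim: k => [|k IHk]; first by rewrite mul1r.
by rewrite exprS -mulrA => /weighted_cancel.
Qed.

End WeightedCancellation.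

Lemma weightedMl n (R : comUnitRingType) (p : R) (w : nat -> nat)
    (a h : mpseries n.+1 R) :
  (forall s t, (s <= t)%N -> (w t <= w s)%N) -> weighted p w h -> weighted p w (a * h).
Proof.
move=> wP hP m; apply: dvdX_sum => k km; apply/dvdXMl/dvdXW/hP/wP.
by rewrite -(sdegB km) leq_addr.
Qed.

(** * Substitution of [q T_j] for [S_j] *)

Section Rescaling.
Variables (n : nat) (R : comPzRingType) (q : R).
Local Notation A := (mpseries n.+1 R).
Local Notation wid := (widen_ord (leqnSn n)).
Implicit Types (a b : A) (F G : mpseries n A).

Definition rescale a : A := fun m => q ^+ sdeg m * a m.

Lemma rescale_zmod : zmod_morphism rescale.
Proof. by move=> a b; apply/funext => m; rewrite [RHS]mps_coefB -mulrBr. Qed.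
Lemma rescale_monoid : monoid_morphism rescale.
Proof.
split=> [|a b]; apply/funext => m.
  rewrite /rescale; have [->|m0] := eqVneq m 0%MM.
    by rewrite sdeg_wid_eq0 ?mul1r // => i; rewrite mnm0E.
  by rewrite mps_coef1 (negPf m0) mulr0.
rewrite /rescale !mps_coefM mulr_sumr; apply: eq_bigr => k km.
by rewrite -(sdegB km) addnC exprD mulrACA.
Qed.
HB.instance Definition _ := GRing.isZmodMorphism.Build A A rescale rescale_zmod.
HB.instance Definition _ :=
  GRing.isMonoidMorphism.Build A A rescale rescale_monoid.

Lemma rescaleC c : rescale (mpsC n.+1 c) = mpsC n.+1 c.
Proof.
apply/funext => m; rewrite /rescale /mpsC; case: eqP => [->|_]; last by rewrite mulr0.
by rewrite sdeg_wid_eq0 ?mul1r // => i; rewrite mnm0E.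
Qed.

Lemma rescale_varS i : rescale (varS R i) = mpsC n.+1 q * varS R i.
Proof.
apply/funext => m; rewrite mps_coefCM /rescale /varS /mpsX.
case: eqP => [->|_]; last by rewrite !mulr0.
congr (_ * _); rewrite /sdeg (bigD1 i) //= mnm1E eqxx big1 // => j ji.
by rewrite mnm1E (inj_eq (@wid_inj _)) eq_sym (negPf ji).
Qed.

(* [subst F] is [F(q T, Z, T)] as a power series in [T, Z], with [T_j] written
   as the variable [S_j]; its coefficients are finite sums, so that no
   convergence is involved. *)
Definition subst_trunc D F : A :=
  \sum_(k : 'X_{1..n < D}) mps_mono (mnmwiden k) * rescale (F k).

Definition subst F : A := fun m => subst_trunc (mdeg m).+1 F m.

(** Terms with [|k| > |m|] are multiples of [T^k] and do not reach the coefficient at [m]. *)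
Lemma subst_truncE D F m : (mdeg m < D)%N -> subst_trunc D F m = subst F m.
Proof.
move=> mD; rewrite /subst /subst_trunc !mps_coef_sum.
pose E (k : 'X_{1..n}) := (mps_mono (mnmwiden k) * rescale (F k)) m.
apply/esym/(@eq_big_widen _ _ +%R _ _ _ ('X_{1..n < (mdeg m).+1} : subFinType _)
  ('X_{1..n < D} : subFinType _) xpredT E) => k.
  by move=> km; apply: leq_trans km _.
rewrite ltnS /E mps_coef_monoM; case: ifP => // km; case/negP.
by rewrite -mdeg_mnmwiden -(submK km) mdegD leq_addl.
Qed.

Lemma subst_zmod : zmod_morphism subst.
Proof.
move=> F G; apply/funext => m; rewrite mps_coefB /subst -mps_coefB.
congr (_ m); rewrite /subst_trunc -sumrB; apply: eq_bigr => k _.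
by rewrite mps_coefB rmorphB mulrBr.
Qed.
HB.instance Definition _ := GRing.isZmodMorphism.Build (mpseries n A) A subst subst_zmod.

Lemma subst_mulC a F : subst (mpsC n a * F) = rescale a * subst F.
Proof.
apply/funext => m; rewrite mps_coefM /subst.
have -> : subst_trunc (mdeg m).+1 (mpsC n a * F) = rescale a * subst_trunc (mdeg m).+1 F.
  rewrite mulr_sumr; apply: eq_bigr => k _.
  by rewrite mps_coefCM rmorphM mulrCA.
rewrite mps_coefM; apply: eq_bigr => k km.
by rewrite [LHS]/= subst_truncE // ltnS mdegB.
Qed.

Lemma subst1 : subst 1 = 1.
Proof.
apply/funext => m; rewrite /subst /subst_trunc.
rewrite (bigD1 (bm0 : 'X_{1..n < (mdeg m).+1})) //= big1 => [|k k0].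
  by rewrite addr0 mnmwiden0 mps_mono0 mul1r /= mps_coef1 eqxx rmorph1.
rewrite mps_coef1 (_ : (k == 0%MM :> 'X_{1..n}) = false) ?rmorph0 ?mulr0 //.
exact: negPf k0.
Qed.

Lemma subst_C a : subst (mpsC n a) = rescale a.
Proof. by rewrite -[mpsC n a]mulr1 subst_mulC subst1 mulr1. Qed.

Lemma subst_mulX j F : subst (mpsX A j * F) = varS R j * subst F.
Proof.
apply/funext => m; rewrite -(@subst_truncE (mdeg m).+2) //.
have -> : subst_trunc (mdeg m).+2 (mpsX A j * F) = varS R j * subst_trunc (mdeg m).+1 F.
  rewrite /subst_trunc mulr_sumr.
  rewrite (bigID (fun k : 'X_{1..n < (mdeg m).+2} => 0 < k j)%N) /=.
  rewrite [X in _ + X]big1 ?addr0 => [|k /negPf kj]; last first.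
    by rewrite mps_coefXM kj rmorph0 mulr0.
  have dU (l : 'X_{1..n < (mdeg m).+1}) : (mdeg (l + U_(j))%MM < (mdeg m).+2)%N.
    by rewrite mdegD mdeg1 addn1 ltnS bmdeg.
  (* The remaining [k] have [k_j > 0] and are shifts by [U_(j)] of multi-indices of degree at most
     [|m|]; on them the default [bm0] is never taken. *)
  pose lower (k : 'X_{1..n < (mdeg m).+2}) : 'X_{1..n < (mdeg m).+1} :=
    insubd bm0 (k - U_(j))%MM.
  rewrite (reindex_onto (fun l => BMultinom (dU l)) lower) /=; last first.
    move=> k kj; have jk : (U_(j) <= k)%MM by rewrite lep1mP -lt0n.
    apply: val_inj; rewrite /= insubdK ?submK //.
    by have := bmdeg k; rewrite -{1}(submK jk) mdegD mdeg1 addn1.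
  apply: eq_big => [l|l _].
    by rewrite mnmDE mnm1E eqxx addn1 /lower /= addmK valKd eqxx.
  rewrite mps_coefXM mnmDE mnm1E eqxx addn1 /= addmK mulrA; congr (_ * _).
  by rewrite /varS -[mpsX _ _]/(mps_mono _) -mps_monoD addmC mnmwidenD mnmwiden1.
rewrite !mps_coefXM; case: ifP => // _; rewrite subst_truncE // ltnS.
exact: mdegB.
Qed.

End Rescaling.

(** * Powers of the ideal [(p, S, Z)] *)

Lemma ideal_gen_sub (K : comPzRingType) (G P : K -> Prop) :
  is_ideal P -> (forall x, G x -> P x) -> forall x, ideal_gen G x -> P x.
Proof.
move=> [P0 PD PM] GP _ [s Gs ->]; rewrite big_seq; apply: big_ind => // x /Gs /GP.
exact: PM.
Qed.

Lemma ideal_expS (K : comPzRingType) (I : K -> Prop) N x y :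
  I x -> ideal_exp I N y -> ideal_exp I N.+1 (x * y).
Proof.
move=> Ix; have [I0 ID IM] : is_ideal (ideal_exp I N.+1) by exact: ideal_genP.
move: y; apply: ideal_gen_sub.
  split=> [|y z Iy Iz|a y Iy]; rewrite ?mulr0 ?mulrDr //; first exact: ID.
  by rewrite mulrCA; apply: IM.
move=> _ [y Iy ->]; apply: mem_ideal_gen.
exists (fun i => if unlift ord0 i is Some j then y j else x).
  by move=> i; case: (unlift ord0 i).
rewrite big_ord_recl unlift_none; congr (_ * _).
by apply: eq_bigr => i _; rewrite liftK.
Qed.

Section AdicIdeal.
Variables (n : nat) (R : comPzRingType) (p : R).
Local Notation A := (OX n R).
Local Notation J := (@adic_ideal n R p).
Implicit Types (a b : A).

(** A coefficientwise description of [J^N]; the two inclusions are [adic_order_exp] and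
    [ideal_exp_order]. *)
Definition adic_order N a : Prop := forall m, dvdX p (N - mdeg m) (a m).

Lemma adic_orderM M N a b :
  adic_order M a -> adic_order N b -> adic_order (M + N) (a * b).
Proof.
move=> aM bN m; apply: dvdX_sum => k km.
apply: dvdXW (dvdXM (aM _) (bN _)).
by have := congr1 mdeg (submK km); rewrite mdegD; lia.
Qed.

Lemma adic_order_ideal N : is_ideal (adic_order N).
Proof.
split=> [m|a b aN bN m|a b bN]; first exact: dvdX0.
  exact: (dvdXD (aN m) (bN m)).
by rewrite -[N]add0n; apply: adic_orderM => // m; apply: dvd0X.
Qed.

Lemma adic_order_exp N a : ideal_exp J N a -> adic_order N a.
Proof.
apply: ideal_gen_sub; first exact: adic_order_ideal.
have J1 b : J b -> adic_order 1 b.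
  apply: ideal_gen_sub; first exact: adic_order_ideal.
  move=> _ [->|[i ->]] m.
    rewrite /piX /mpsC; case: eqP => _; last exact: dvdX0.
    by apply: dvdXW (leq_subr _ _) _; exists 1; rewrite mul1r.
  rewrite /mpsX; case: eqP => [->|_]; last exact: dvdX0.
  by rewrite mdeg1; apply: dvd0X.
move=> _ [y Jy ->]; elim: N y Jy => [|N IHN] y Jy.
  by move=> m; apply: dvd0X.
by rewrite big_ord_recl; apply: (@adic_orderM 1 N); [apply: J1 | apply: IHN].
Qed.

(** By induction on [N]: the constant term is [p] times a constant of order [N]. Every other
    monomial is assigned to the first variable dividing it, so that each is counted once, and
    dividing by that variable lowers the order by at most one. *)
Lemma ideal_exp_order N a : adic_order N a -> ideal_exp J N a.
Proof.
elim: N a => [|N IHN] a aN.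
  have [_ _ JM] : is_ideal (ideal_exp J 0) by exact: ideal_genP.
  rewrite -[a]mulr1; apply/JM/mem_ideal_gen.
  by exists (fun _ => 0) => [[]|]; rewrite ?big_ord0.
have [J0 JD _] : is_ideal (ideal_exp J N.+1) by exact: ideal_genP.
pose fst_var (m : 'X_{1..n.+1}) := [pick i | 0 < m i]%N.
pose part i : A := fun m =>
  if fst_var (m + U_(i))%MM == Some i then a (m + U_(i))%MM else 0.
have [c a0] := aN 0%MM; rewrite mdeg0 subn0 in a0.
have -> : a = piX n p * mpsC n.+1 (c * p ^+ N) + \sum_i mpsX R i * part i.
  apply/funext => m; rewrite mps_coefD mps_coef_sum.
  rewrite /piX -rmorphM /= mulrCA -exprS -a0.
  have -> : \sum_i (mpsX R i * part i) m = \sum_(i | fst_var m == Some i) a m.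
    rewrite [RHS]big_mkcond; apply: eq_bigr => i _; rewrite mps_coefXM /part.
    case: ifP => mi; first by rewrite submK // lep1mP -lt0n.
    case: eqP => // E; move: mi; rewrite /fst_var in E; move: E.
    by case: pickP => // j mj [<-]; rewrite mj.
  rewrite /mpsC; case: eqP => [->|/eqP m0].
    rewrite big_pred0 ?addr0 // => i; rewrite /fst_var.
    by case: pickP => // j; rewrite mnm0E.
  rewrite add0r /fst_var; case: pickP => [i _|m0'].
    by rewrite (big_pred1 i) // => j; rewrite /= eq_sym.
  case/eqP: m0; apply/mnmP => i; rewrite mnm0E; apply/eqP.
  by rewrite -leqn0 leqNgt m0'.
apply: (JD).
  apply: ideal_expS; first by apply: mem_ideal_gen; left.
  apply: IHN => m; rewrite /mpsC; case: eqP => _; last exact: dvdX0.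
  by apply: dvdXW (leq_subr _ _) _; exists c.
apply: big_ind => [||i _]; [exact: J0 | exact: JD | apply: ideal_expS].
  by apply: mem_ideal_gen; right; exists i.
apply: IHN => m; rewrite /part; case: ifP => _; last exact: dvdX0.
by apply: dvdXW (aN _); rewrite mdegD mdeg1; lia.
Qed.

End AdicIdeal.

(** * Elimination of the [S_j] and the kernel of the substitution *)

Section Elimination.
Variables (n r : nat) (R : comPzRingType) (p : R).
Local Notation A := (mpseries n.+1 R).
Local Notation wid := (widen_ord (leqnSn n)).
Local Notation q := (p ^+ r.+1).
Local Notation J := (@adic_ideal n R p).
Implicit Types (F G : mpseries n A) (j l : 'I_n) (k : 'X_{1..n}) (m : 'X_{1..n.+1}).

Definition chart_rel j : mpseries n A :=
  mpsC n (mpsC n.+1 q) * mpsX A j - mpsC n (varS R j).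

Lemma chart_rel_mulE j G k m : (chart_rel j * G) k m =
  (if (0 < k j)%N then q * G (k - U_(j))%MM m else 0)
  - (if (0 < m (wid j))%N then G k (m - U_(wid j))%MM else 0).
Proof.
rewrite /chart_rel mulrBl -mulrA mps_coefB mps_coefB !mps_coefCM mps_coefXM.
rewrite /varS mps_coefXM; congr (_ - _).
by case: ifP => //; rewrite mulr0.
Qed.

Lemma subst_chart_rel j G : subst q (chart_rel j * G) = 0.
Proof.
rewrite /chart_rel mulrBl -mulrA raddfB /= !subst_mulC subst_mulX.
by rewrite rescaleC rescale_varS mulrA subrr.
Qed.

(* The quotient of the division of [F] by [S_j - q T_j], considered as
   polynomials in [S_j]; the remainder is [F] with [q T_j] for [S_j]. *)
Definition elim_quot j F : mpseries n A := fun k m =>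
  \sum_(b < (k j).+1) q ^+ b * F (k - U_(j) *+ b)%MM (m + U_(wid j) *+ b.+1)%MM.

(** Terms with [b >= N] are divisible by [p^N] through [q^b]. In the others [F] is taken at degree
    at least [D]: the shift by [S_j^(b+1)] costs [b+1] in the order, [q^b] gives back at least [b],
    and the remaining unit is why [D] is chosen for [N+1]. *)
Lemma elim_quot_restricted j F :
  F \in restricted J -> elim_quot j F \in restricted J.
Proof.
move=> /asboolP rF; apply/asboolP => N; have [D DP] := rF N.+1.
exists (D + N)%N => k kD; apply: ideal_exp_order => m.
apply: dvdX_sum => b _; have [bN|Nb] := leqP N b.
  apply/dvdXMr/dvdXW; last by exists 1; rewrite mul1r -exprM.
  by apply: leq_trans (leq_subr _ _) (leq_trans bN (leq_pmull _ _)).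
have bk : (U_(j) *+ b <= k)%MM.
  apply/mnm_lepP => i; rewrite mulmnE mnm1E; case: eqP => [<-|//].
  by rewrite mul1n -ltnS.
have /DP/adic_order_exp/(_ (m + U_(wid j) *+ b.+1)%MM) : (D <= mdeg (k - U_(j) *+ b))%N.
  by move: kD; rewrite -{1}(submK bk) mdegD mdegMn mdeg1; lia.
rewrite mdegD mdegMn mdeg1 => FP; rewrite -exprM.
apply: dvdXW (dvdXM (d := b * r.+1) _ FP); last by rewrite mulnC; exists 1; rewrite mul1r.
nia.
Qed.

(** The sum telescopes: the term [b = 0] of the quotient at [m - U_(wid j)] cancels [F k m], and its
    other terms cancel [q] times the quotient at [k - U_(j)]. *)
Lemma elim_var j F k m : (0 < m (wid j))%N ->
  (F + chart_rel j * elim_quot j F) k m = 0.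
Proof.
move=> mj; rewrite !mps_coefD chart_rel_mulE mj [X in _ - X]/elim_quot.
rewrite big_ord_recl /= mul1r.
have Um : (U_(wid j) <= m)%MM by rewrite lep1mP -lt0n.
rewrite mulm0n subm0 mulm1n submK // opprD addrCA addNKr.
apply/eqP; rewrite subr_eq0; apply/eqP; case: ifP => [kj|/negbT]; last first.
  by rewrite -leqNgt leqn0 => /eqP ->; rewrite big_ord0.
rewrite /elim_quot mnmBE mnm1E eqxx subn1 prednK // mulr_sumr.
apply: eq_bigr => b _; rewrite mulrA -exprS /bump leq0n add1n; congr (_ * F _ _).
  by rewrite submDA -mulmS.
by rewrite [in RHS]mulmS addmA submK.
Qed.

(** Dividing by the relation for [j] only shifts exponents of [S_j] and [T_j], so an [S_l]
    eliminated earlier does not reappear. *)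
Lemma elim_var_support j l F : (forall k m, (0 < m (wid l))%N -> F k m = 0) ->
  forall k m, (0 < m (wid l))%N -> (F + chart_rel j * elim_quot j F) k m = 0.
Proof.
have [<-|jl] := eqVneq j l; first by move=> _; apply: elim_var.
move=> F0 k m ml; rewrite !mps_coefD.
have Q0 k' m' : (0 < m' (wid l))%N -> elim_quot j F k' m' = 0.
  by move=> m'l; apply: big1 => b _; rewrite F0 ?mulr0 // mnmDE addn_gt0 m'l.
rewrite chart_rel_mulE F0 // add0r !Q0 ?mulr0 ?if_same ?subrr //.
by rewrite mnmBE mnm1E (inj_eq (@wid_inj _)) (negPf jl) subn0.
Qed.

(** Without the [S_j], the substitution merely relabels the monomials [T^k Z^i], so the coefficients
    of [F] can be read off. *)
Lemma subst_S_free F k m : (forall l, m (wid l) = 0%N) ->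
  (forall k m l, (0 < m (wid l))%N -> F k m = 0) ->
  subst q F (mnmwiden k + m)%MM = F k m.
Proof.
move=> m0 F0; rewrite /subst /subst_trunc mps_coef_sum.
have kd : (mdeg k < (mdeg (mnmwiden k + m)).+1)%N.
  by rewrite ltnS mdegD mdeg_mnmwiden leq_addr.
rewrite (bigD1 (BMultinom kd)) //= mps_coef_monoM lem_addr.
have -> : (mnmwiden k + m - mnmwiden k)%MM = m by rewrite addmC addmK.
rewrite /rescale sdeg_wid_eq0 // mul1r big1 ?addr0 // => l lk.
rewrite mps_coef_monoM; case: ifP => // lkm.
(* Any other [T^l] dividing the monomial leaves a positive exponent of some [S_i] in the cofactor,
   where [F l] vanishes. *)
have [i li] : exists i, l i <> k i.
  by apply/existsNP => E; case/eqP: lk; apply/val_inj/mnmP.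
rewrite (F0 _ _ i) ?mulr0 // mnmBE mnmDE mnmwiden_widen m0 addn0.
rewrite mnmwiden_widen subn_gt0.
move/mnm_lepP: lkm => /(_ (wid i)); rewrite mnmDE m0 addn0 !mnmwiden_widen; lia.
Qed.

Local Notation OXT := (@OXT n R p).
Local Notation rel := (@blowup_rel n r R p).

Definition substT (F : OXT) : A := subst q (\val F).

Lemma substT_zmod : zmod_morphism substT.
Proof. by move=> F G; rewrite /substT rmorphB raddfB. Qed.
HB.instance Definition _ := GRing.isZmodMorphism.Build OXT A substT substT_zmod.

Lemma substT_mulC a (F : OXT) : substT (rpsC n J a * F) = rescale q a * substT F.
Proof. by rewrite /substT rmorphM; apply: subst_mulC. Qed.

Lemma substT_C a : substT (rpsC n J a) = rescale q a.
Proof. exact: subst_C. Qed.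

Lemma val_blowup_rel j : \val (rpsC n J (piX n p) ^+ r.+1 * rpsX J j
   - rpsC n J (varS R j)) = chart_rel j.
Proof. by rewrite rmorphB rmorphM rmorphXn /= -!rmorphXn. Qed.

Lemma subst_ideal0 (F : OXT) : ideal_gen rel F -> substT F = 0.
Proof.
move=> [s sP ->]; rewrite raddf_sum big_seq big1 // => x /sP[j ->].
rewrite /= /substT rmorphM [X in _ * X](val_blowup_rel j) mulrC.
exact: subst_chart_rel.
Qed.

Lemma elim_S (F : OXT) t : (t <= n)%N -> exists F' : OXT, ideal_gen rel (F - F') /\
  forall k m (l : 'I_n), (l < t)%N -> (0 < m (wid l))%N -> \val F' k m = 0.
Proof.
have [I0 ID IM] := ideal_genP rel.
elim: t => [_|t IHt tn]; first by exists F; rewrite subrr.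
have [F' [FF' F'0]] := IHt (ltnW tn); pose j := Ordinal tn.
pose G : OXT := RPSeries (elim_quot_restricted j (valP F')).
pose rj : OXT := rpsC n J (piX n p) ^+ r.+1 * rpsX J j - rpsC n J (varS R j).
exists (F' + rj * G); split.
  have -> : F - (F' + rj * G) = (F - F') + (- G) * rj by ring.
  by apply: ID => //; apply/IM/mem_ideal_gen; exists j.
move=> k m l; rewrite ltnS leq_eqVlt => /orP[/eqP lj|lt] ml;
  rewrite rmorphD rmorphM [X in _ + X * _](val_blowup_rel j).
  by rewrite elim_var // [j](_ : _ = l) //; apply: val_inj.
by apply: (@elim_var_support j l) => // k' m'; apply: F'0.
Qed.

(** This is the injectivity of [O(X') -> R[[T,Z]]]: modulo the relations [F] is free of all [S_j],
    and on such series the substitution is injective. *)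
Lemma ideal_subst0 (F : OXT) : substT F = 0 -> ideal_gen rel F.
Proof.
move=> F0; have [F' [FF' F'S]] := elim_S F (leqnn n).
suff F'0 : F' = 0 by rewrite F'0 subr0 in FF'.
have sF' : substT F' = 0.
  have := subst_ideal0 FF'; rewrite raddfB /= F0 sub0r => /eqP.
  by rewrite oppr_eq0 => /eqP.
apply: val_inj; apply/funext => k; apply/funext => m; rewrite [RHS]/(0 : R).
have [m0|] := pselect (forall l, m (wid l) = 0%N).
  by rewrite -subst_S_free // => [|k' m' l]; [rewrite [subst _ _]sF' | apply: F'S].
by move/existsNP => [l /eqP]; rewrite -lt0n; apply: F'S.
Qed.

End Elimination.

(** * Congruences in the completed localization; the order of a distinguished series *)

(** Clearing denominators turns a congruence of fractions into one in [K] up to a power of [f], a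
    form to which the Gauss lemma applies. *)
Lemma loc_level_eqP (K : comPzRingType) (p f : K) N a k b l :
  quot_pi _ (frac f a k) = quot_pi _ (frac f b l) :> level (loc_of f p) N <->
  exists t c, f ^+ t * (f ^+ l * a - f ^+ k * b) = c * p ^+ N.
Proof.
have subE : frac f a k - frac f b l = frac f (f ^+ l * a - f ^+ k * b) (k + l).
  change (loc_add (frac f a k) (loc_opp (frac f b l)) =
    frac f (f ^+ l * a - f ^+ k * b) (k + l)).
  by rewrite loc_oppE loc_addE mulrN.
have mulE c u : frac f c u * loc_of f p ^+ N = frac f (c * p ^+ N) u.
  rewrite -rmorphXn; change (loc_mul (frac f c u) (frac f (p ^+ N) 0) =
    frac f (c * p ^+ N) u).
  by rewrite loc_mulE addn0.
rewrite level_eqP subE; split=> [[c]|[t [c E]]].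
  elim/fracW: c => c u; rewrite mulE => /frac_eqP[s E].
  by exists (s + u)%N, (f ^+ (s + (k + l)) * c); rewrite E mulrA.
exists (frac f c (t + (k + l))); rewrite mulE.
by apply: frac_eq; rewrite -E mulrA -exprD addnC.
Qed.

Lemma adic_level_le (K : comPzRingType) (p : K) (g : adic_completion p) N M x :
  (N <= M)%N -> adic_val g M = quot_pi _ x -> adic_val g N = quot_pi _ x.
Proof.
move=> /subnK <-; elim: (M - N)%N => //= d IHd gx; apply: IHd.
have /asboolP/(_ (d + N)%N)[y [gy gy']] := adic_valP g.
rewrite gy; apply/level_eqP.
have /level_eqP[c cP] : quot_pi _ y = quot_pi _ x :> level p (d + N).+1.
  by rewrite -gy' -gx.
by exists (c * p); rewrite cP exprS mulrA.
Qed.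

(** Here [d] is the order in [Z] of the nonzero reduction of [f]; a coefficient not divisible by the
    uniformizer is a unit. *)
Lemma distinguished_order (R : idomainType) (p : R) n (f : mpseries n.+1 R) :
  dvr_uniformizer p -> Z_distinguished p f ->
  exists d, f (monZ n d) \is a GRing.unit /\
    forall i, (i < d)%N -> dvdX p 1 (f (monZ n i)).
Proof.
case=> _ unitP _ [f0 _].
have exd : exists d, ~~ `[< dvdX p 1 (f (monZ n d)) >].
  apply: contrapT => /forallNP fd; apply: f0; apply/funext => m.
  have /negP/negPn/asboolP[c cP] := fd (m ord0).
  change (quot_pi (fun x => x = p) (f (monZ n (m ord0))) = 0).
  rewrite -(rmorph0 (quot_pi _)); apply/quot_idealP; rewrite subr0 cP.
  by have [_ _ IM] := ideal_genP (fun x => x = p); apply/IM/mem_ideal_gen.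
case: (ex_minnP exd) => d /asboolP fd dmin; exists d; split.
  apply/negPn/negP => /unitP[c cP]; apply: fd.
  by exists c; rewrite expr1.
move=> i id; apply/asboolP/negPn/negP => /dmin; rewrite leqNgt id //.
Qed.

(** * Descent of [h] and [g] to a power series in [S] and [Z] *)

Section Descent.
Variables (R : idomainType) (p : R) (n r : nat).
Hypothesis p_neq0 : p != 0.
Local Notation A := (mpseries n.+1 R).
Local Notation q := (p ^+ r.+1).
Local Notation J := (@adic_ideal n R p).

Lemma dvdX_cancel e d x : dvdX p e (p ^+ d * x) -> dvdX p (e - d) x.
Proof.
have [ed|de] := leqP e d; first by rewrite (eqP ed : (e - d = 0)%N) => _; apply: dvd0X.
move=> [c cP]; exists c; apply: (mulfI (expf_neq0 d p_neq0)).
by rewrite cP mulrCA -exprD addnC subnK // ltnW.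
Qed.

Variables (f : A) (d : nat).
Hypothesis f_unit : f (monZ n d) \is a GRing.unit.
Hypothesis f_low : forall i, (i < d)%N -> dvdX p 1 (f (monZ n i)).

(** For a nonincreasing weight the differences in [F_weight] are zero. *)
Lemma weighted_fX (w : nat -> nat) N k (h : A) :
  (forall s, w s <= N)%N -> (forall s t, (s <= t)%N -> (w t <= w s)%N) ->
  weighted p w (f ^+ k * h) -> weighted p w h.
Proof.
move=> wN wd; apply: (weighted_cancelX f_unit f_low wN) => m s.
have := wd s (sdeg m + s)%N (leq_addl _ _); rewrite -subn_eq0 => /eqP ->.
exact: dvd0X.
Qed.

(** The weight may grow by [r+1] per [S]-degree, since the coefficient of [rescale q f] at [m] is
    divisible by [q^(sdeg m)]. *)
Lemma weighted_rescaled_fX (w : nat -> nat) N k (h : A) :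
  (forall s, w s <= N)%N -> (forall s t, w (s + t) <= s * r.+1 + w t)%N ->
  weighted p w (rescale q f ^+ k * h) -> weighted p w h.
Proof.
have rE i : rescale q f (monZ n i) = f (monZ n i) by rewrite /rescale sdeg_monZ mul1r.
move=> wN wd; apply: (@weighted_cancelX _ _ p (rescale q f) d _ _ w N) => //.
- by rewrite rE.
- by move=> i id; rewrite rE; apply: f_low.
move=> m s; rewrite /rescale -exprM; apply/dvdXMr.
apply: (@dvdXW _ _ _ (sdeg m * r.+1)); first by rewrite leq_subLR [leqRHS]addnC.
by rewrite mulnC; exists 1; rewrite mul1r.
Qed.

Variables (g : loc_completion (piX n p) f) (F : OXT n p).
Hypothesis gF : loc_completion_map (blowup n r p) g =
  loc_completion_of (blowup n r p (piX n p)) (blowup n r p f) (quot_pi _ F).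
Local Notation H := (substT r F).

(** At level [N] the hypothesis [gF] gives, up to a power of [f], a congruence modulo [p^N] and the
    blowup relations. The substitution kills the relations, and the Gauss lemma with constant weight
    removes the power of [f]. *)
Lemma local_expansion N a k : adic_val g N = quot_pi _ (frac f a k) ->
  weighted p (fun _ => N) (rescale q a - rescale q f ^+ k * H).
Proof.
move=> gN.
have : quot_pi _ (frac (blowup n r p f) (blowup n r p a) k) =
    quot_pi _ (frac (blowup n r p f) (quot_pi _ F) 0)
    :> level (loc_of (blowup n r p f) (blowup n r p (piX n p))) N.
  have := congr1 (fun x : adic_completion _ => \val x N) gF.
  rewrite /= => <-; rewrite (adic_seq_mapE (loc_mapE (blowup n r p) f (piX n p) 0) gN).
  by rewrite /= loc_mapE.
move=> /loc_level_eqP[t [b]]; have [B ->] : exists B, b = quot_pi _ B.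
  by exists (repr b); apply/esym/reprK.
rewrite expr0 mul1r /blowup /= -!rmorphXn -!rmorphM -rmorphB -rmorphM.
move=> /quot_idealP/subst_ideal0.
rewrite [B * _]mulrC raddfB /= !substT_mulC raddfB /= substT_C substT_mulC.
move=> /eqP; rewrite subr_eq0 => /eqP E.
apply: (@weighted_rescaled_fX _ N t) => // [s u|]; first exact: leq_addl.
rewrite -rmorphXn E rescaleC => m; rewrite mps_coefCM.
by exists (substT r B m); rewrite mulrC.
Qed.

Lemma local_expansion_dvd N a k : adic_val g N = quot_pi _ (frac f a k) ->
  weighted p (fun s => minn N (s * r.+1)) H.
Proof.
move=> /local_expansion ga; apply: (@weighted_rescaled_fX _ N k).
- by move=> s; apply: geq_minl.
- by move=> s t; lia.
move=> m; have -> : rescale q f ^+ k * H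
    = rescale q a - (rescale q a - rescale q f ^+ k * H) by rewrite opprB addrC subrK.
apply: dvdXB; last by apply: dvdXW (ga m); apply: geq_minl.
rewrite /rescale -exprM; apply/dvdXMr/dvdXW; first exact: geq_minr.
by rewrite mulnC; exists 1; rewrite mul1r.
Qed.

Lemma locally_frac N : exists a k, adic_val g N = quot_pi _ (frac f a k).
Proof.
have [x ->] := adic_repr (adic_val g) N.
by elim/fracW: x => a k; exists a, k.
Qed.

Lemma rescale_descent : exists a, H = rescale q a.
Proof.
have /choice[a aP] m : exists c, H m = c * p ^+ (sdeg m * r.+1).
  (* At this level the minimum in [local_expansion_dvd] equals [(r+1) sdeg m]. *)
  have [b [k gb]] := locally_frac (sdeg m * r.+1).
  by have := local_expansion_dvd gb m; rewrite minnn.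
by exists a; apply/funext => m; rewrite aP /rescale mulrC mulnC exprM.
Qed.

Lemma blowup_descent a : H = rescale q a -> blowup n r p a = quot_pi _ F.
Proof.
move=> Ha; apply/esym/quot_idealP/ideal_subst0.
by rewrite raddfB /= substT_C Ha subrr.
Qed.

Lemma loc_descent a : H = rescale q a -> loc_completion_of (piX n p) f a = g.
Proof.
move=> Ha; apply/val_inj/functional_extensionality_dep => N.
have [b [k gb]] := locally_frac N; rewrite [RHS]gb.
apply/esym/loc_level_eqP; exists 0%N.
rewrite !mul1r; apply: mps_dvd => m.
(* With this [M] the weight [min(N, M - (r+1)s)] takes the value [N] at [s = L]. *)
pose L := sdeg m; pose M := (N + L * r.+1)%N.
have [c [l gc]] := locally_frac M.
have NM : (N <= M)%N by rewrite leq_addr.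
have [t [e E]] : exists t e, f ^+ t * (f ^+ l * b - f ^+ k * c) = e * piX n p ^+ N.
  by apply/loc_level_eqP; rewrite -gb (adic_level_le NM gc).
(* The rescaled series agree modulo [p^M]; cancelling [q^s] in [S]-degree [s] leaves divisibility by
   [p^(M - (r+1)s)]. *)
have cP : weighted p (fun s => minn N (M - s * r.+1)) (c - f ^+ l * a).
  move=> m'; apply: dvdXW (geq_minr _ _) _; apply: dvdX_cancel.
  have := local_expansion gc m'.
  rewrite Ha -rmorphXn -rmorphM -rmorphB /= /rescale -exprM.
  by rewrite [(r.+1 * _)%N]mulnC.
suff /(_ m) : weighted p (fun s => minn N (M - s * r.+1)) (b - f ^+ k * a).
  by rewrite /M addnK minnn.
have wd s u : (s <= u)%N -> (minn N (M - u * r.+1) <= minn N (M - s * r.+1))%N.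
  by move=> su; have := leq_mul su (leqnn r.+1); lia.
apply: (@weighted_fX _ N (t + l)) => // [s|]; first exact: geq_minl.
(* Passing through [c] splits the difference into a multiple of [p^N] and a multiple of [c - f^l a],
   which is controlled by [cP]. *)
have -> : f ^+ (t + l) * (b - f ^+ k * a) =
    f ^+ t * (f ^+ l * b - f ^+ k * c) + f ^+ (t + k) * (c - f ^+ l * a).
  by rewrite !exprD; ring.
move=> m'; rewrite mps_coefD; apply: dvdXD; last exact: (weightedMl _ wd cP m').
apply: dvdXW (geq_minl _ _) _; rewrite E; apply: mps_dvd_coef.
by exists e.
Qed.

End Descent.

(** * Uniqueness and conclusion *)

(** After substitution, the blowup map multiplies each coefficient by a power of [q], which is
    nonzero in the domain [R]. *)
Lemma blowup_inj (R : idomainType) (p : R) (n r : nat) :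
  p != 0 -> injective (blowup n r p).
Proof.
move=> p0 a b /quot_idealP/subst_ideal0; rewrite raddfB /= !substT_C => /eqP.
rewrite subr_eq0 => /eqP ab; apply/funext => m.
apply: (mulfI (expf_neq0 (sdeg m) (expf_neq0 r.+1 p0))).
exact: (congr1 (fun x : OX n R => x m) ab).
Qed.

Theorem theorem5p12 (R : idomainType) (pi : R) (n r : nat)
    (hR : complete_dvr pi)
    (f : OX n R) (hf : Z_distinguished pi f)
    (g : loc_completion (piX n pi) f)
    (h : OX' n r pi)
    (hgh : loc_completion_map (blowup n r pi) g
           = loc_completion_of (blowup n r pi (piX n pi)) (blowup n r pi f) h) :
  exists! a : OX n R,
    loc_completion_of (piX n pi) f a = g /\ blowup n r pi a = h.
Proof.
have [unif _] := hR; have [_ _ pi0] := unif.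
have [d [f_unit f_low]] := distinguished_order unif hf.
have [F hF] : exists F, h = quot_pi _ F by exists (repr h); apply/esym/reprK.
subst h.
have [a Ha] := rescale_descent pi0 f_unit f_low hgh.
exists a; split; first by split; [apply: (loc_descent pi0 f_unit f_low hgh)
                                 | apply: blowup_descent].
move=> b [_ hb]; apply: (blowup_inj pi0); apply: (etrans _ (esym hb)).
exact: blowup_descent.
Qed.
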